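(* Let $\mathcal H=\{\langle w_1\rangle,\dots,\langle w_T\rangle\}\subset\mathbf{RP}^n$ be a finite set of $T$ distinct points with $\mathrm{span}(w_1,\dots,w_T)=\mathbf R^{n+1}$, and let $p=(p_1,\dots,p_T)$ be a probability distribution on $\mathcal H$ ($p_i\ge0$, $\sum_i p_i=1$, $p_i$ the weight of $\langle w_i\rangle$). Then $$\eta^{\bigstar}_n(\mathcal H)=\sum_{W\in\mathcal H^{\times n}_{\ne0}}\frac{1-\sum_{j:\ \langle w_j\rangle\subset \mathrm{span}(W)}p_j}{W[\mathcal H]},$$ where for $W=(\langle w_{i_1}\rangle,\dots,\langle w_{i_n}\rangle)$, $\mathrm{span}(W)=\mathrm{span}(w_{i_1},\dots,w_{i_n})$ and the inner sum runs over all $j\in[T]$ with $\langle w_j\rangle$ contained in this span.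
   Context: $\mathbf{RP}^n$ is the set of $1$-dimensional subspaces of $\mathbf R^{n+1}$; $\langle v\rangle$ is the line spanned by $v\ne0$. For a finite $\mathcal H=\{\langle w_1\rangle,\dots,\langle w_T\rangle\}$ and an order (bijection) $\pi:[T]\to\mathcal H$, $\pi(i)=\langle w_i\rangle$, an ordered $n$-tuple $(\langle w_{i_1}\rangle,\dots,\langle w_{i_n}\rangle)$ of distinct elements satisfies the $\eta^\pi_n(\mathcal H)$ condition if (1) $2\le i_1<\dots<i_n\le T$, and (2) for every $l$, $\langle w_{i_l}\rangle$ is the $\pi$-minimal point of $\mathcal H$ contained in $\mathrm{span}(w_{i_l},\dots,w_{i_n})$. The number of such tuples with $w_{i_1},\dots,w_{i_n}$ linearly independent is known not to depend on $\pi$ and is denoted $\eta^{\bigstar}_n(\mathcal H)$. $\mathcal H^{\times n}_{\ne0}$ denotes the set of ordered $n$-tuples $W=(\langle w_{i_1}\rangle,\dots,\langle w_{i_n}\rangle)$ of distinct elements of $\mathcal H$ with $w_{i_1},\dots,w_{i_n}$ linearly independent. For such $W$ and $l=1,\dots,n$, let $q^W_l$ be the number of points of $\mathcal H$ contained in $\mathrm{span}(w_{i_{n-l+1}},\dots,w_{i_n})$ (the span of the last $l$ entries), and $W[\mathcal H]=q^W_n q^W_{n-1}\cdots q^W_1$. *)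

(* Defs.v *)
From HB Require Import structures.
From mathcomp Require Import all_boot all_order all_algebra.
From mathcomp Require Import finmap.
From mathcomp Require Import reals.

Set Implicit Arguments.
Unset Strict Implicit.
Unset Printing Implicit Defensive.

Import Order.TTheory GRing.Theory Num.Theory.
Local Open Scope ring_scope.
Local Open Scope fset_scope.

Record rpoint (R : realType) (n : nat) := RPoint {
  line :> {vspace 'rV[R]_n.+1};
  _ : \dim line == 1%N }.

HB.instance Definition _ (R : realType) (n : nat) :=
  [isSub for @line R n].
HB.instance Definition _ (R : realType) (n : nat) :=
  [Choice of rpoint R n by <:].

(* A spanning vector [w] of the line [x = <w>].  Spans and linear independence
   do not depend on this choice. *)
Definition rep (R : realType) (n : nat) (x : rpoint R n) : 'rV[R]_n.+1 :=
  vpick x.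

Lemma line_rep (R : realType) (n : nat) (x : rpoint R n) :
  line x = <[rep x]>%VS.
Proof.
apply/esym/eqP; case: x => V dV; rewrite /rep /= eqEdim -memvE memv_pick /=.
by rewrite dim_vline vpick0 -dimv_eq0 (eqP dV).
Qed.

Definition reps (R : realType) (n : nat) (H : {fset rpoint R n}) (s : seq H) :
  seq 'rV[R]_n.+1 := [seq rep (val x) | x <- s].

Definition pspan (R : realType) (n : nat) (H : {fset rpoint R n}) (s : seq H) :
  {vspace 'rV[R]_n.+1} := <<reps s>>%VS.

(* The set H^{x n}_{<> 0}. *)
Definition indep_tuples (R : realType) (n : nat) (H : {fset rpoint R n}) :
  {set n.-tuple H} := [set W : n.-tuple H | uniq W && free (reps W)].

(* Positions are numbered from 0, so that [2 <= i_1] becomes [0 < i_1] (and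
   hence [0 < i_l] for all [l]), and [drop l W] lists the entries of [W] from
   the one at position [l] on.  As that entry lies in the span of [drop l W],
   its minimality only asks that no point of [H] in the span come earlier. *)
Definition eta_cond (R : realType) (n : nat) (H : {fset rpoint R n})
    (pi : 'I_#|` H| -> H) (W : n.-tuple H) : bool :=
  [exists i : n.-tuple 'I_#|` H|,
    [&& W == [tuple of map pi i],
        all (fun k : 'I_#|` H| => (0 < k)%N) i,
        sorted ltn (map val i) &
        [forall l : 'I_n, forall j : 'I_#|` H|,
          (line (val (pi j)) <= pspan (drop l W))%VS ==> (tnth i l <= j)%N]]].

(* The number eta^pi_n(H); eta^star is its common value over all orders [pi]. *)
Definition eta_num (R : realType) (n : nat) (H : {fset rpoint R n})
    (pi : 'I_#|` H| -> H) : nat :=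
  #|[set W in indep_tuples H | eta_cond pi W]|.

(* q^W_l : the number of points of [H] in the span of the last [l] entries. *)
Definition qW (R : realType) (n : nat) (H : {fset rpoint R n})
    (W : n.-tuple H) (l : nat) : nat :=
  #|[set x : H | (line (val x) <= pspan (drop (n - l) W))%VS]|.

(* The number W[H]. *)
Definition bracket (R : realType) (n : nat) (H : {fset rpoint R n})
    (W : n.-tuple H) : nat := (\prod_(1 <= l < n.+1) qW W l)%N.

(* Main.v *)
(** Fix a weight [u G x] for every flat [G] and every point [x] of [G], with
    total weight 1 on each nonempty [G], and weigh an independent tuple [W] by
    the product of the weights of its entries [w_l] in the flats spanned by
    [w_l, ..., w_n].  As for Weisner's recursion for the Moebius function of a
    geometric lattice, an exchange argument shows that the total weight of the
    tuples whose span [G] satisfies [a \notin G] and [cl (a |: G) = F] depends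
    neither on the point [a] of [F] nor on [u].  With [F] the whole space,
    putting all the weight of [G] on its [pi]-minimal point and taking
    [a = pi 0] gives [eta_num pi], while the uniform weights, averaged over [a]
    with respect to [p], give the right-hand side. *)

Require Import Defs.
From HB Require Import structures.
From mathcomp Require Import all_boot all_order all_algebra.
From mathcomp Require Import finmap.
From mathcomp Require Import reals.

Set Implicit Arguments.
Unset Strict Implicit.
Unset Printing Implicit Defensive.

Import Order.TTheory GRing.Theory Num.Theory.
Local Open Scope ring_scope.
Local Open Scope fset_scope.

(** * Flats and coverings in a finite loopless matroid *)

Section WeightedFlags.

Local Open Scope ring_scope.

Variables (T : finType) (cl : {set T} -> {set T}).
Hypothesis sub_cl : forall A : {set T}, A \subset cl A.
Hypothesis clS : forall A B : {set T}, A \subset B -> cl A \subset cl B.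
Hypothesis cl_id : forall A, cl (cl A) = cl A.
Hypothesis cl_exchange : forall (A : {set T}) x y,
  y \in cl (x |: A) -> y \notin cl A -> x \in cl (y |: A).
Hypothesis cl0 : cl set0 = set0.

Lemma cl_min (A B : {set T}) : A \subset cl B -> cl A \subset cl B.
Proof. by move/clS; rewrite cl_id. Qed.

Lemma cl_setU1 a (K : {set T}) : cl (a |: cl K) = cl (a |: K).
Proof.
apply/eqP; rewrite eqEsubset; apply/andP; split; last by rewrite clS ?setUS.
apply: cl_min; rewrite subUset (clS (subsetUr _ _)) andbT sub1set.
by rewrite (subsetP (sub_cl _)) ?setU11.
Qed.

(** By exchange this means that [F] covers [K] in the lattice of flats and that [a] lies in [F] but
    not in [K]. *)
Definition extends a (K F : {set T}) :=
  [&& cl K == K, a \notin K & cl (a |: K) == F].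

Lemma extends_mem a (K F : {set T}) : extends a K F -> a \in F.
Proof.
by case/and3P=> _ _ /eqP<-; rewrite (subsetP (sub_cl _)) ?setU11.
Qed.

Lemma extends_exchange a b (K F : {set T}) :
  b \in F -> b \notin K -> extends a K F -> extends b K F.
Proof.
move=> Fb nKb /and3P[/eqP clK nKa /eqP defF]; apply/and3P; split=> //.
  exact/eqP.
have a_bK : a \in cl (b |: K) by apply: cl_exchange; rewrite ?defF ?clK.
have b_aK : b \in cl (a |: K) by rewrite defF.
rewrite eqEsubset -defF; apply/andP; split; apply: cl_min.
  rewrite subUset sub1set b_aK.
  exact: subset_trans (subsetUr _ _) (sub_cl _).
rewrite subUset sub1set a_bK.
exact: subset_trans (subsetUr _ _) (sub_cl _).
Qed.

Lemma extends_notinC a b (G F : {set T}) : a \in F -> b \in F ->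
  extends a G F && (b \notin G) = extends b G F && (a \notin G).
Proof.
move=> Fa Fb; apply/andP/andP=> -[eG nG]; split.
- exact: extends_exchange eG.
- by case/and3P: eG.
- exact: extends_exchange eG.
- by case/and3P: eG.
Qed.

(** Both sides say that [a], [b] are independent over the flat [L] and span [F] together with it, a
    condition symmetric in [a] and [b]. *)
Lemma extends2C a b (F L : {set T}) :
  (cl L == L) && (b \notin L) && extends a (cl (b |: L)) F =
  (cl L == L) && (a \notin L) && extends b (cl (a |: L)) F.
Proof.
wlog suff main : a b / (cl L == L) && (b \notin L) && extends a (cl (b |: L)) F
    -> (cl L == L) && (a \notin L) && extends b (cl (a |: L)) F.
  by apply/idP/idP; apply: main.
case/andP=> /andP[/eqP clL nLb] /and3P[_ nbLa /eqP defF].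
have nLa : a \notin L.
  apply: contra nbLa => La; apply: (subsetP (sub_cl _)).
  by rewrite inE La orbT.
rewrite nLa clL eqxx /=; apply/and3P; split; first by rewrite cl_id.
  by apply: contra nbLa => /cl_exchange; apply; rewrite clL.
by rewrite -defF !cl_setU1 setUCA.
Qed.

(** * Weighted flag sums and their independence of the weights *)

Variable K : fieldType.
Implicit Types u v : {set T} -> T -> K.

Definition ext_sum (f : {set T} -> K) a F := \sum_(G | extends a G F) f G.

(** Total weight of the independent [k]-tuples with closure [G], computed by peeling off the first
    entry [x]. Points outside [G] contribute 0, since [extends x L G] forces [x] into [G]. *)
Fixpoint flag_sum u k (G : {set T}) : K :=
  if k is k'.+1 then \sum_x u G x * ext_sum (flag_sum u k') x G
  else (G == set0)%:R.

Definition weight_system u :=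
  forall G : {set T}, G != set0 -> \sum_(x in G) u G x = 1.

(** The left side averages [ext_sum] over the points of [G] with weights of sum 1, and the average
    of a constant is its value at [b]. *)
Lemma flag_sumS u k b (G : {set T}) : weight_system u ->
  {in G &, forall x y,
    ext_sum (flag_sum u k) x G = ext_sum (flag_sum u k) y G} ->
  b \in G -> flag_sum u k.+1 G = ext_sum (flag_sum u k) b G.
Proof.
move=> wu extE Gb /=; rewrite (bigID (mem G)) /= [X in _ + X]big1 => [|x nGx].
  rewrite addr0 -[RHS]mul1r -(wu G); last by apply/set0Pn; exists b.
  by rewrite mulr_suml; apply: eq_bigr => x Gx; rewrite (extE x b).
rewrite /ext_sum big_pred0 ?mulr0 // => L.
by apply: contraNF nGx; apply: extends_mem.
Qed.

(* Flats below [F] avoiding both [a] and [b] contribute equally; expanding the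
   others once more along the second point leaves a sum over the flats [L] such
   that [F] is spanned by [L] and the independent pair [a], [b]. *)
Lemma ext_sum_const u k (F : {set T}) : weight_system u ->
  {in F &, forall a b,
    ext_sum (flag_sum u k) a F = ext_sum (flag_sum u k) b F}.
Proof.
move=> wu; elim: k F => [|k IHk] F a b Fa Fb; rewrite /ext_sum.
  rewrite (bigID [pred G : {set T} | b \in G]) /=.
  rewrite [RHS](bigID [pred G : {set T} | a \in G]) /=.
  (* At [k = 0] only the empty flat has nonzero weight, and it contains neither point. *)
  rewrite [X in X + _]big1 => [|G /andP[_ Gb]]; last first.
    by case: eqP => // G0; rewrite G0 inE in Gb.
  rewrite [in RHS]big1 => [|G /andP[_ Ga]]; last first.
    by case: eqP => // G0; rewrite G0 inE in Ga.
  by congr (_ + _); apply: eq_bigl => G; apply: extends_notinC.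
rewrite (bigID [pred G : {set T} | b \in G]) /=.
rewrite [RHS](bigID [pred G : {set T} | a \in G]) /=.
congr (_ + _); last by apply: eq_bigl => G; apply: extends_notinC.
have expand c d : \sum_(G | extends c G F && (d \in G)) flag_sum u k.+1 G =
    \sum_(L | (cl L == L) && (d \notin L) && extends c (cl (d |: L)) F)
      flag_sum u k L.
  transitivity (\sum_(G | extends c G F && (d \in G))
                  ext_sum (flag_sum u k) d G).
    (* The induction hypothesis on [G] allows the evaluation at [d]. *)
    by apply: eq_bigr => G /andP[_ Gd]; apply: flag_sumS => //; apply: IHk.
  rewrite /ext_sum (exchange_big_dep (fun L =>
    (cl L == L) && (d \notin L) && extends c (cl (d |: L)) F)) /=.
    apply: eq_bigr => L /andP[/andP[clL nLd] eL].
    rewrite (big_pred1 (cl (d |: L))) // => G /=.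
    rewrite /(extends d L) clL nLd /= eq_sym.
    case: eqP => [->|_]; rewrite ?andbF // eL andbT /=.
    by rewrite (subsetP (sub_cl _)) ?setU11.
  by move=> G L /andP[eG Gd] /and3P[-> -> /eqP->].
by rewrite !expand; apply: eq_bigl => L; apply: extends2C.
Qed.

(** Evaluating at a point of [G] removes the weights of level [G]; those below are handled by
    induction. *)
Lemma flag_sum_indep u v k : weight_system u -> weight_system v ->
  flag_sum u k =1 flag_sum v k.
Proof.
move=> wu wv; elim: k => // k IHk G.
have [-> | [b Gb]] := set_0Vmem G.
  rewrite /= !big1 // => x _; rewrite /ext_sum big_pred0 ?mulr0 // => L;
    by apply/negP=> /extends_mem; rewrite inE.
rewrite !(flag_sumS (b := b)) //; try exact: ext_sum_const.
by apply: eq_bigr => L _; apply: IHk.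
Qed.

Lemma ext_sum_indep u v k (F : {set T}) a b :
  weight_system u -> weight_system v -> a \in F -> b \in F ->
  ext_sum (flag_sum u k) a F = ext_sum (flag_sum v k) b F.
Proof.
move=> wu wv Fa Fb; rewrite (ext_sum_const _ wu Fa Fb).
by apply: eq_bigr => L _; apply: flag_sum_indep.
Qed.

(** * Flag sums as sums over independent tuples *)

Definition cls (s : seq T) := cl [set x in s].

Fixpoint indep (s : seq T) :=
  if s is x :: s' then (x \notin cls s') && indep s' else true.

Fixpoint seq_weight u (s : seq T) : K :=
  if s is x :: s' then u (cls s) x * seq_weight u s' else 1.

Lemma cls_cons x s : cls (x :: s) = cl (x |: cls s).
Proof. by rewrite cl_setU1; congr cl; apply/setP=> y; rewrite !inE. Qed.

Lemma cls_nil : cls [::] = set0.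
Proof. by rewrite -[RHS]cl0; congr cl; apply/setP=> y; rewrite !inE. Qed.

Lemma mem_cls s : {subset s <= cls s}.
Proof. by move=> x sx; apply: (subsetP (sub_cl _)); rewrite inE. Qed.

Lemma extends_cls x s F :
  extends x (cls s) F = (x \notin cls s) && (cls (x :: s) == F).
Proof. by rewrite /extends cl_id eqxx cls_cons. Qed.

Lemma big_tupleS k (P : pred (seq T)) (f : seq T -> K) :
  \sum_(W : k.+1.-tuple T | P W) f W =
  \sum_x \sum_(W : k.-tuple T | P (x :: W)) f (x :: W).
Proof.
rewrite pair_big_dep /=.
rewrite (reindex (fun xW : T * k.-tuple T => [tuple of xW.1 :: xW.2])) //=.
exists (fun W : k.+1.-tuple T => (thead W, [tuple of behead W])) => [[x W]|W] _.
  by congr pair; apply/val_inj.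
by rewrite /= -tuple_eta.
Qed.

Lemma big_tuple0 (P : pred (seq T)) (f : seq T -> K) :
  \sum_(W : 0.-tuple T | P W) f W = if P [::] then f [::] else 0.
Proof.
rewrite big_mkcond (big_pred1 [tuple]) // => W.
by apply/esym/eqP; rewrite (tuple0 W).
Qed.

(** Each independent tuple [W] is counted exactly once, at the flat [G = cls W]. *)
Lemma ext_sum_tuples (f : {set T} -> K) (g : seq T -> K) k a F :
  (forall G, f G = \sum_(W : k.-tuple T | indep W && (cls W == G)) g W) ->
  ext_sum f a F = \sum_(W : k.-tuple T | indep W && extends a (cls W) F) g W.
Proof.
move=> fE; rewrite /ext_sum; under eq_bigr do rewrite fE.
rewrite (exchange_big_dep (fun W : k.-tuple T =>
  indep W && extends a (cls W) F)) /=; last first.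
  by move=> G W eG /andP[-> /eqP->].
apply: eq_bigr => W /andP[iW eW].
rewrite (big_pred1 (cls W)) // => G /=.
by rewrite iW [RHS]eq_sym; case: eqP => [<-|]; rewrite ?andbF ?andbT.
Qed.

Lemma flag_sumE u k F :
  flag_sum u k F =
  \sum_(W : k.-tuple T | indep W && (cls W == F)) seq_weight u W.
Proof.
elim: k F => [|k IHk] F /=.
  rewrite (big_tuple0 (fun s => indep s && (cls s == F)) (seq_weight u)) /=.
  by rewrite cls_nil eq_sym; case: eqP.
rewrite (big_tupleS k (fun s => indep s && (cls s == F)) (seq_weight u)).
apply: eq_bigr => x _; rewrite (ext_sum_tuples _ _ IHk) mulr_sumr.
apply: eq_big => W; first by rewrite extends_cls andbCA andbA.
by rewrite extends_cls /= => /andP[_ /andP[_ /eqP->]].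
Qed.

Lemma ext_sumE u k a F :
  ext_sum (flag_sum u k) a F =
  \sum_(W : k.-tuple T | indep W && extends a (cls W) F) seq_weight u W.
Proof. exact/ext_sum_tuples/flag_sumE. Qed.

(** * The uniform weights and the weights on first points *)

Definition uniform_weight (G : {set T}) (x : T) : K := #|G|%:R^-1.

Lemma seq_weight_uniform s :
  seq_weight uniform_weight s =
  \prod_(0 <= l < size s) #|cls (drop l s)|%:R^-1.
Proof.
elim: s => [|x s IHs]; first by rewrite big_geq.
by rewrite [LHS]/= IHs big_nat_recl // drop0.
Qed.

Definition first_in (rk : T -> nat) (G : {set T}) x :=
  (x \in G) && [forall y in G, (rk x <= rk y)%N].

Definition first_weight rk (G : {set T}) x : K := (first_in rk G x)%:R.

Lemma weight_system_first rk : injective rk -> weight_system (first_weight rk).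
Proof.
move=> rkI G /set0Pn[x0 Gx0].
have [x /= Gx minx] := @arg_minnP _ x0 (mem G) rk Gx0.
have {}Gx : x \in G by [].
rewrite (bigD1 x) //= big1 ?addr0 => [|y /andP[Gy y'x]].
  rewrite /first_weight /first_in Gx.
  by have /forall_inP-> : forall y, y \in G -> (rk x <= rk y)%N by exact: minx.
rewrite /first_weight /first_in Gy /=.
case: forall_inP => // /(_ x Gx) le_yx; case/eqP: y'x; apply: rkI.
by apply/eqP; rewrite eqn_leq le_yx minx.
Qed.

Fixpoint first_flag rk (s : seq T) :=
  if s is x :: s' then first_in rk (cls s) x && first_flag rk s' else true.

Lemma seq_weight_first rk s :
  seq_weight (first_weight rk) s = (first_flag rk s)%:R.
Proof. by elim: s => //= x s ->; rewrite -natrM mulnb. Qed.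

(** Each entry is first in a flat containing the next entry; independence makes the two distinct, so
    the ranks increase strictly. *)
Lemma first_flag_sorted rk s :
  injective rk -> indep s -> first_flag rk s -> sorted ltn (map rk s).
Proof.
move=> rkI; elim: s => //= x [|y s] //= IHs /andP[nx ix].
case/andP=> /andP[_ /forall_inP minx] fs; rewrite IHs // andbT.
have xy : y \in cls [:: x, y & s] by rewrite mem_cls ?inE ?eqxx ?orbT.
rewrite ltn_neqAle minx // andbT (inj_eq rkI).
by apply: contraNneq nx => ->; rewrite mem_cls ?mem_head.
Qed.

Lemma first_flagP x0 rk s :
  reflect (forall l, (l < size s)%N ->
             first_in rk (cls (drop l s)) (nth x0 s l))
          (first_flag rk s).
Proof.
elim: s => [|x s IHs] /=; first by left.
apply: (iffP andP) => [[fx /IHs fs] [|l] //|fs].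
  exact: fs.
split; first exact: (fs 0).
by apply/IHs => l; apply: (fs l.+1).
Qed.

Lemma weight_system_uniform :
  [pchar K] =i pred0 -> weight_system uniform_weight.
Proof.
move=> charK G; rewrite -card_gt0 => G_gt0.
rewrite /uniform_weight sumr_const -[LHS]mulr_natr mulVf //.
by rewrite (pcharf0P K).1 // -lt0n.
Qed.

End WeightedFlags.

(** * The matroid of a finite set of projective points *)

Section ProjectivePoints.

Local Open Scope ring_scope.

Variables (R : realType) (n : nat) (H : {fset rpoint R n}).
Implicit Types (A B : {set H}) (x y : H) (s : seq H).

Definition span_cl A : {set H} :=
  [set x : H | (line (val x) <= pspan (enum A))%VS].

Lemma line_le_pspan x s :
  (line (val x) <= pspan s)%VS = (rep (val x) \in pspan s).
Proof. by rewrite line_rep memvE. Qed.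

Lemma pspanS s s' : {subset s <= s'} -> (pspan s <= pspan s')%VS.
Proof.
move=> ss'; apply: sub_span => _ /mapP[x sx ->].
by apply: map_f; apply: ss'.
Qed.

Lemma eq_pspan s s' : s =i s' -> pspan s = pspan s'.
Proof. by move=> ss'; apply: eq_span; apply: eq_mem_map. Qed.

Lemma pspan_cons x s : pspan (x :: s) = (<[rep (val x)]> + pspan s)%VS.
Proof. exact: span_cons. Qed.

Lemma pspan_setU1 x A :
  pspan (enum (x |: A)) = (<[rep (val x)]> + pspan (enum A))%VS.
Proof.
by rewrite -pspan_cons; apply: eq_pspan => y; rewrite !inE !mem_enum !inE.
Qed.

Lemma clsE s : cls span_cl s = [set x : H | (line (val x) <= pspan s)%VS].
Proof.
apply/setP=> x; rewrite !inE; congr (_ <= _)%VS.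
by apply: eq_pspan => y; rewrite mem_enum inE.
Qed.

Lemma sub_span_cl A : A \subset span_cl A.
Proof.
apply/subsetP=> x Ax; rewrite inE line_le_pspan.
by apply: memv_span; apply: map_f; rewrite mem_enum.
Qed.

Lemma span_clS A B : A \subset B -> span_cl A \subset span_cl B.
Proof.
move/subsetP=> sAB; apply/subsetP=> x; rewrite !inE => /subv_trans-> //.
by apply: pspanS => y; rewrite !mem_enum; apply: sAB.
Qed.

Lemma span_cl_id A : span_cl (span_cl A) = span_cl A.
Proof.
apply/eqP; rewrite eqEsubset sub_span_cl andbT; apply/subsetP=> x.
rewrite !inE => /subv_trans-> //; apply/span_subvP=> _ /mapP[y Ay ->].
by move: Ay; rewrite mem_enum inE line_le_pspan.
Qed.

(** If [y = c x + w] with [w] in the span of [A], then [c] is nonzero, so the equation can be solved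
    for [x]. *)
Lemma span_cl_exchange A x y :
  y \in span_cl (x |: A) -> y \notin span_cl A -> x \in span_cl (y |: A).
Proof.
rewrite !inE !line_le_pspan !pspan_setU1.
case/memv_addP=> _ /vlineP[c ->] [w Aw ->] nAy.
have [c0 | nz_c] := eqVneq c 0; first by rewrite c0 scale0r add0r Aw in nAy.
apply/memv_addP; exists (c^-1 *: (c *: rep (val x) + w)).
  by rewrite memvZ ?memv_line.
exists (- (c^-1 *: w)); first by rewrite memvN memvZ.
by rewrite scalerDr scalerA mulVf // scale1r addrK.
Qed.

Lemma span_cl0 : span_cl set0 = set0.
Proof.
apply/setP=> x; rewrite !inE enum_set0 /pspan /reps /= span_nil subv0.
by case: (val x) => V /= /eqP; rewrite -dimv_eq0; case: eqP => // ->.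
Qed.

Lemma indepE s : indep span_cl s = free (reps s).
Proof.
elim: s => [|x s IHs]; first by rewrite /= nil_free.
by rewrite [LHS]/= /reps /= free_cons IHs clsE inE line_le_pspan.
Qed.

Lemma indep_tuplesE (W : n.-tuple H) :
  (W \in indep_tuples H) = indep span_cl W.
Proof.
by rewrite inE indepE andb_idl // => /free_uniq; apply: map_uniq.
Qed.

(** A point outside the span of [n] independent ones completes them to a basis of the space of
    dimension [n.+1]. *)
Lemma extends_setT x (W : n.-tuple H) : indep span_cl W ->
  extends span_cl x (cls span_cl W) [set: H] = (x \notin cls span_cl W).
Proof.
move=> iW.
rewrite (extends_cls sub_span_cl span_clS span_cl_id) andb_idr // => nWx.
have fxW : free (reps (x :: W)) by rewrite -indepE /= nWx.
have pT : pspan (x :: W) = fullv.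
  apply/eqP; rewrite eqEdim subvf /= (eqP fxW) size_map /= size_tuple.
  by rewrite dimvf /= /dim /= mul1n.
by apply/eqP/setP=> y; rewrite clsE !inE pT subvf.
Qed.

Lemma ext_sum_setT u x :
  ext_sum span_cl (flag_sum span_cl u n) x [set: H] =
  \sum_(W in indep_tuples H | x \notin cls span_cl W)
    seq_weight span_cl u W :> R.
Proof.
rewrite (ext_sumE sub_span_cl span_clS span_cl_id span_cl0).
apply: eq_bigl => W; rewrite indep_tuplesE.
by case: (boolP (indep _ _)) => // iW; rewrite extends_setT.
Qed.

Lemma bracketE (W : n.-tuple H) :
  seq_weight span_cl (@uniform_weight _ R) W = (bracket W)%:R^-1.
Proof.
(* One product starts from the whole tuple, the other from its last entry; reversing one aligns the
   factors. *)
rewrite seq_weight_uniform size_tuple /bracket big_add1 big_nat_rev add0n.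
rewrite natr_prod -prodfV; apply: eq_big_nat => l /andP[_ ltln].
by rewrite clsE.
Qed.

(** Given minimality, excluding position 0 amounts to [x0] lying outside the span: inside it, [x0]
    would have to be the first entry. The increasing order of positions follows from minimality and
    independence. *)
Lemma eta_condE (pi : 'I_#|` H| -> H) (rk : H -> 'I_#|` H|) (x0 : H)
    (W : n.-tuple H) :
  cancel pi rk -> cancel rk pi -> rk x0 = 0%N :> nat -> indep span_cl W ->
  eta_cond pi W =
  (x0 \notin cls span_cl W) && first_flag span_cl (fun x => val (rk x)) W.
Proof.
move=> piK rkK rk0 iW.
have rkI : injective (fun x => val (rk x)).
  by move=> x y /val_inj /(can_inj rkK).
apply/existsP/andP=> [[i /and4P[/eqP defW i_gt0 _ /forallP minW]]|[nx fW]].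
  have minP : first_flag span_cl (fun x => val (rk x)) W.
    apply/(first_flagP span_cl x0 _ _) => l; rewrite size_tuple => ltln.
    apply/andP; split.
      apply: (mem_cls sub_span_cl); rewrite (drop_nth x0) ?size_tuple //.
      exact: mem_head.
    apply/forall_inP=> y; rewrite clsE inE => Wy.
    have /forallP/(_ (rk y)) := minW (Ordinal ltln).
    have -> : nth x0 W l = pi (tnth i (Ordinal ltln)).
      by rewrite -(tnth_nth x0 _ (Ordinal ltln)) {1}defW tnth_map.
    by rewrite rkK piK Wy.
  split=> //; apply/negP=> Wx0.
  (* With [n = 0] there is no first entry to compare with [x0], but the closure is empty. *)
  case: (posnP n) => [n0 | n_gt0].
    move: Wx0; rewrite (size0nil (etrans (size_tuple W) n0)).
    by rewrite (cls_nil span_cl0) inE.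
  have /forallP/(_ (rk x0)) := minW (Ordinal n_gt0).
  move: Wx0; rewrite -[X in cls _ X]drop0 clsE inE rkK => -> /=.
  by rewrite rk0 leqNgt (allP i_gt0) ?mem_tnth.
exists [tuple of map rk W]; apply/and4P; split.
- by apply/eqP/val_inj; rewrite /= -map_comp map_id_in // => x _; apply: rkK.
- apply/allP=> _ /mapP[x Wx ->]; rewrite lt0n -rk0 (inj_eq rkI).
  by apply: contraNneq nx => <-; apply: (mem_cls sub_span_cl).
- by rewrite -map_comp; apply: (first_flag_sorted sub_span_cl).
apply/forallP=> l; apply/forallP=> j; apply/implyP=> Wj.
have ltl : (l < size W)%N by rewrite size_tuple.
have /andP[_ /forall_inP/(_ (pi j))] := first_flagP _ x0 _ _ fW l ltl.
by rewrite clsE inE piK => /(_ Wj); rewrite tnth_map (tnth_nth x0).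
Qed.

End ProjectivePoints.

(** * Averaging over the base point *)

Theorem theorem3 (R : realType) (n : nat) (H : {fset rpoint R n})
    (Hspan : pspan (enum {: H}) = fullv)
    (p : H -> R) (p_ge0 : forall x : H, 0 <= p x) (p_sum1 : \sum_(x : H) p x = 1)
    (pi : 'I_#|` H| -> H) (pi_bij : bijective pi) :
  (eta_num pi)%:R =
  \sum_(W in indep_tuples H)
    (1 - \sum_(x : H | (line (val x) <= pspan W)%VS) p x) / (bracket W)%:R :> R.
Proof.
(* Total weight 1 makes [H] nonempty, so that position 0 exists. *)
have [x1 _] : exists x1 : H, p x1 != 0.
  apply/existsP; apply: contraT => /existsPn p0.
  move: p_sum1; rewrite big1 => [/esym/eqP|x _]; first by rewrite oner_eq0.
  exact/eqP/negbNE/p0.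
have [rk piK rkK] := pi_bij.
have N_gt0 : (0 < #|` H|)%N := leq_ltn_trans (leq0n _) (ltn_ord (rk x1)).
pose x0 := pi (Ordinal N_gt0).
have rk0 : rk x0 = 0%N :> nat by rewrite piK.
pose first : {set H} -> H -> R := first_weight R (fun x => val (rk x)).
have w_first : weight_system first.
  by apply: weight_system_first => x y /val_inj/(can_inj rkK).
have w_unif : weight_system (@uniform_weight H R).
  by apply: weight_system_uniform; apply: pchar_num.
have etaE : (eta_num pi)%:R =
    ext_sum (@span_cl _ _ H) (flag_sum (@span_cl _ _ H) first n) x0 setT :> R.
  rewrite ext_sum_setT /eta_num -sum1_card natr_sum.
  rewrite big_mkcond [RHS]big_mkcond; apply: eq_bigr => W _.
  rewrite inE; case: (boolP (W \in indep_tuples H)) => //= iW.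
  rewrite indep_tuplesE in iW.
  rewrite (eta_condE piK rkK rk0 iW) seq_weight_first.
  by case: (_ \notin _); case: first_flag.
(* The count becomes a [p]-average of copies of itself; in the copy for [x], the base point [x0] is
   then moved to [x] and the weights are made uniform. *)
rewrite etaE -[LHS]mul1r -{1}p_sum1 mulr_suml.
transitivity (\sum_x p x *
    \sum_(W in indep_tuples H | x \notin cls (@span_cl _ _ H) W)
      (bracket W)%:R^-1).
  apply: eq_bigr => x _; congr (_ * _).
  rewrite (ext_sum_indep (@sub_span_cl _ _ H) (@span_clS _ _ H)
    (@span_cl_id _ _ H) (@span_cl_exchange _ _ H) n w_first w_unif
    (in_setT x0) (in_setT x)).
  by rewrite ext_sum_setT; apply: eq_bigr => W _; rewrite bracketE.
under eq_bigr do rewrite mulr_sumr.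
rewrite (exchange_big_dep (mem (indep_tuples H))) /=; last first.
  by move=> x W _ /andP[].
apply: eq_bigr => W iW; rewrite -mulr_suml; congr (_ / _).
(* The factor of [W] is now the [p]-mass outside its span, hence 1 minus the mass inside. *)
rewrite -{1}p_sum1 (bigID (fun x : H => (line (val x) <= pspan W)%VS) predT).
rewrite /= addrC addrK.
by apply: eq_bigl => x; rewrite iW clsE inE.
Qed.
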